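(* Let $K$ be a commutative ring, let $Q$ and $Q'$ be two finite quivers on the same set of vertices, and let $W$, $W'$ be potentials on $Q$, $Q'$ respectively. If $(Q,W)$ and $(Q',W')$ are right equivalent (respectively, weakly right equivalent) as potentials, then the hyperpotentials $(Q,(\partial_\alpha W)_{\alpha\in Q_1})$ and $(Q',(\partial_\beta W')_{\beta\in Q'_1})$ are right equivalent (respectively, weakly right equivalent) as hyperpotentials. Conversely, if $K$ contains $\mathbb Q$ and the hyperpotentials $(Q,(\partial_\alpha W)_{\alpha\in Q_1})$ and $(Q',(\partial_\beta W')_{\beta\in Q'_1})$ are right equivalent (respectively, weakly right equivalent) as hyperpotentials, then $(Q,W)$ and $(Q',W')$ are right equivalent (respectively, weakly right equivalent) as potentials.
   Context: For a finite quiver $Q$ with vertices $Q_0$ and arrows $Q_1$, paths are composed from left to right; for an arrow $\alpha\colon i\to j$ put $s(\alpha)=i$, $t(\alpha)=j$. $A=\widehat{KQ}$ is the completed path algebra (possibly infinite $K$-linear combinations of paths), $e_i$ is the trivial path at $i$, so $\alpha\in e_{s(\alpha)}Ae_{t(\alpha)}$. For $Q'$ write $A'=\widehat{KQ'}$ with idempotents $e'_i$. $\widehat\otimes$ is the completed tensor product over $K$. Let $\sigma\colon A\to A$ be the continuous linear map with $\sigma(e_i)=e_i$ and $\sigma(\alpha_1\cdots\alpha_n)=\alpha_n\alpha_1\cdots\alpha_{n-1}$ (so $\sigma$ vanishes on paths that are not cycles). Put $\mathrm{HH}_0(A)=A_\sigma=\operatorname{Coker}(\mathrm{id}-\sigma)$: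 infinite linear combinations of cycles modulo rotation. Potentials are the elements of $(A_+)_\sigma$, where $A_+\subset A$ is the set of infinite linear combinations of non-trivial paths. The cyclic derivative with respect to $\alpha\in Q_1$ is given by $\partial_\alpha(\alpha_1\cdots\alpha_n)=\sum_{j:\alpha_j=\alpha}\alpha_{j+1}\cdots\alpha_n\alpha_1\cdots\alpha_{j-1}$ on cycles, extended linearly and continuously. A hyperpotential on $Q$ is a collection $(\rho_\alpha)_{\alpha\in Q_1}$ with $\rho_\alpha\in e_{t(\alpha)}Ae_{s(\alpha)}$ and $\sum_{\alpha\in Q_1}[\alpha,\rho_\alpha]=0$. A potential $W$ is regarded as the hyperpotential $(\partial_\alpha W)_{\alpha\in Q_1}$. Right equivalence of potentials: $(Q,W)$ and $(Q',W')$ are right equivalent if there is a continuous algebra isomorphism $\varphi\colon A\to A'$ with $\varphi(e_i)=e'_i$ for all $i$ such that the induced map $\varphi_*\colon\mathrm{HH}_0(A)\to\mathrm{HH}_0(A')$ satisfies $\varphi_*(W)=W'$; they are weakly right equivalent if there are such $\varphi$ and some $c\in K^\times$ with $\varphi_*(cW)=W'$. Right equivalence of hyperpotentials: for $\beta\in Q'_1$, let $\Delta_\beta\colon A'\to A'\widehat\otimes A'$ be the continuous linear map with $\Delta_\beta(e'_i)=0$ and $\Delta_\beta(\beta_1\cdots\beta_n)=\sum_{j:\beta_j=\beta}\beta_1\cdots\beta_{j-1}\otimes\beta_{j+1}\cdots\beta_n$ on paths (empty products are the appropriate trivial paths), and let $(a\otimes b)\diamond x=bxa$, extended linearly and continuously.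 For a continuous algebra homomorphism $\varphi\colon A\to A'$ with $\varphi(e_i)=e'_i$ for all $i$, $\varphi_*((\rho_\alpha)_{\alpha\in Q_1})$ is the hyperpotential on $Q'$ with component $\sum_{\alpha\in Q_1}\Delta_\beta(\varphi(\alpha))\diamond\varphi(\rho_\alpha)$ at $\beta\in Q'_1$. $(Q,(\rho_\alpha))$ and $(Q',(\rho'_\beta))$ are right equivalent if there is a continuous algebra isomorphism $\varphi\colon A\to A'$ with $\varphi(e_i)=e'_i$ for all $i$ and $\varphi_*((\rho_\alpha))=(\rho'_\beta)$; they are weakly right equivalent if there is $c\in K^\times$ such that $(Q,(c\rho_\alpha))$ and $(Q',(\rho'_\beta))$ are right equivalent.
   Formalization: The converse for all continuous algebra isomorphisms is stated for reduced K containing Q; over any K containing Q it is stated with both equivalences restricted to isomorphisms φ with φ(A_+) ⊂ A'_+, since x ↦ x+c with c nilpotent is otherwise a counterexample. *)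

(* Defs.v *)
From HB Require Import structures.
From mathcomp Require Import all_boot all_order all_algebra.
From mathcomp Require Import generic_quotient ring_quotient.
From mathcomp Require Import boolp.

Set Implicit Arguments.
Unset Strict Implicit.
Unset Printing Implicit Defensive.

Import GRing.Theory.

Local Open Scope ring_scope.
Local Open Scope quotient_scope.

Record quiver (V : finType) := Quiver {
  arrow : finType;
  src : arrow -> V;
  tgt : arrow -> V
}.

Section Paths.
Variables (V : finType) (Q : quiver V).

Fixpoint composable (i : V) (s : seq (arrow Q)) : bool :=
  if s is a :: s' then (src a == i) && composable (tgt a) s' else true.

Fixpoint endpoint (i : V) (s : seq (arrow Q)) : V :=
  if s is a :: s' then endpoint (tgt a) s' else i.

(* A path is a source vertex with a composable sequence of arrows, read from
   left to right; the source is only informative when the sequence is empty. *)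
Record qpath := QPath {
  qpath_val : V * seq (arrow Q);
  qpathP : composable qpath_val.1 qpath_val.2
}.

HB.instance Definition _ := [isSub for qpath_val].
HB.instance Definition _ := [Countable of qpath by <:].

Definition source (p : qpath) : V := (qpath_val p).1.
Definition arrows (p : qpath) : seq (arrow Q) := (qpath_val p).2.
Definition target (p : qpath) : V := endpoint (source p) (arrows p).
Definition plen (p : qpath) : nat := size (arrows p).
Definition is_cycle (p : qpath) : bool := target p == source p.

Lemma composable_cat i s t :
  composable i (s ++ t) = composable i s && composable (endpoint i s) t.
Proof. by elim: s i => //= a s IHs i; rewrite IHs andbA. Qed.

Lemma endpoint_cat i s t : endpoint i (s ++ t) = endpoint (endpoint i s) t.
Proof. by elim: s i => /=. Qed.

Lemma ptakeP k (p : qpath) : composable (source p) (take k (arrows p)).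
Proof.
have := qpathP p; rewrite -/(source p) -/(arrows p) -{1}(cat_take_drop k (arrows p)).
by rewrite composable_cat => /andP[].
Qed.

Lemma pdropP k (p : qpath) :
  composable (endpoint (source p) (take k (arrows p))) (drop k (arrows p)).
Proof.
have := qpathP p; rewrite -/(source p) -/(arrows p) -{1}(cat_take_drop k (arrows p)).
by rewrite composable_cat => /andP[].
Qed.

Lemma parrowP (a : arrow Q) : composable (src a) [:: a].
Proof. by rewrite /= eqxx. Qed.

Definition ptriv (i : V) : qpath := @QPath (i, [::]) isT.
Definition parrow (a : arrow Q) : qpath := @QPath (src a, [:: a]) (parrowP a).
Definition ptake k p : qpath := @QPath (source p, take k (arrows p)) (ptakeP k p).
Definition pdrop k p : qpath :=
  @QPath (endpoint (source p) (take k (arrows p)), drop k (arrows p)) (pdropP k p).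

Lemma qpath_eq (p q : qpath) : source p = source q -> arrows p = arrows q -> p = q.
Proof.
move=> e1 e2; apply: val_inj; move: e1 e2; rewrite /source /arrows /=.
by case: (qpath_val p) (qpath_val q) => [? ?] [? ?] /= -> ->.
Qed.

Lemma qpath_eqE (p q : qpath) :
  (p == q) = (source p == source q) && (arrows p == arrows q).
Proof.
apply/eqP/andP => [-> //|[/eqP ? /eqP ?]]; exact: qpath_eq.
Qed.

Lemma ptake_ptake l k p : (l <= k)%N -> ptake l (ptake k p) = ptake l p.
Proof. by move=> lk; apply: qpath_eq => //=; rewrite /arrows /= take_takel. Qed.

Lemma pdrop_ptake l k p :
  (l <= k)%N -> pdrop l (ptake k p) = ptake (k - l) (pdrop l p).
Proof.
move=> lk; apply: qpath_eq; rewrite /source /arrows /=; first by rewrite take_takel.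
by rewrite take_drop subnK.
Qed.

Lemma pdrop_pdrop k l p : pdrop l (pdrop k p) = pdrop (k + l) p.
Proof.
apply: qpath_eq; rewrite /source /arrows /=.
  by rewrite takeD endpoint_cat.
by rewrite drop_drop addnC.
Qed.

Lemma plen_ptake k p : (k <= plen p)%N -> plen (ptake k p) = k.
Proof. by move=> kp; rewrite /plen /arrows /= size_takel. Qed.

Lemma plen_pdrop k p : plen (pdrop k p) = (plen p - k)%N.
Proof. by rewrite /plen /arrows /= size_drop. Qed.

Lemma ptake_oversize k p : (plen p <= k)%N -> ptake k p = p.
Proof. by move=> pk; apply: qpath_eq => //; rewrite /arrows /= take_oversize. Qed.

Lemma pdrop0 p : pdrop 0 p = p.
Proof. by apply: qpath_eq; rewrite /source /arrows /= ?take0 ?drop0. Qed.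

Lemma target_ptake (b : arrow Q) (p : qpath) j : (j < plen p)%N -> target (ptake j p) = src (nth b (arrows p) j).
Proof.
move=> jp; have := qpathP p; rewrite -/(source p) -/(arrows p).
rewrite -{1}(cat_take_drop j (arrows p)) (drop_nth b) // composable_cat /=.
by case/and3P => _ /eqP -> _.
Qed.

Lemma source_pdrop (b : arrow Q) (p : qpath) j :
  (j < plen p)%N -> source (pdrop j.+1 p) = tgt (nth b (arrows p) j).
Proof.
by move=> jp; rewrite /source /= (take_nth b) // -cats1 endpoint_cat.
Qed.

Lemma source_cat (p q : qpath) b t :
  arrows p = arrows q ++ b :: t -> target q = src b -> source p = source q.
Proof.
move=> pq qb; have := qpathP p; have := qpathP q.
rewrite -!/(source _) -!/(arrows _) pq; move: qb; rewrite /target.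
case: (arrows q) => [|c u] /= => [-> _ /andP[/eqP //]|_].
by move=> /andP[/eqP <- _] /andP[/eqP].
Qed.

Lemma composable_inj i j s : composable i s -> composable j s ->
  endpoint i s = endpoint j s -> i = j.
Proof. by case: s => [|a s] //= /andP[/eqP <- _] /andP[/eqP]. Qed.

End Paths.

Arguments ptriv {V Q} i.

Section CompletedPathAlgebra.
Variables (K : comPzRingType) (V : finType) (Q : quiver V).

(* The completed path algebra: x stands for the formal sum of (x p) p over all
   paths p. *)
Record cpa := Cpa { coef :> qpath Q -> K }.

Lemma cpaP (x y : cpa) : (forall p, x p = y p) -> x = y.
Proof. by case: x y => [x] [y] /= /funext ->. Qed.

HB.instance Definition _ := gen_eqMixin cpa.
HB.instance Definition _ := gen_choiceMixin cpa.

Definition cpa0 : cpa := Cpa (fun=> 0).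
Definition cpa_add (x y : cpa) : cpa := Cpa (fun p => x p + y p).
Definition cpa_opp (x : cpa) : cpa := Cpa (fun p => - x p).

Fact cpa_addA : associative cpa_add.
Proof. by move=> x y z; apply: cpaP => p /=; rewrite addrA. Qed.
Fact cpa_addC : commutative cpa_add.
Proof. by move=> x y; apply: cpaP => p /=; rewrite addrC. Qed.
Fact cpa_add0 : left_id cpa0 cpa_add.
Proof. by move=> x; apply: cpaP => p /=; rewrite add0r. Qed.
Fact cpa_addN : left_inverse cpa0 cpa_opp cpa_add.
Proof. by move=> x; apply: cpaP => p /=; rewrite addNr. Qed.

HB.instance Definition _ :=
  GRing.isZmodule.Build cpa cpa_addA cpa_addC cpa_add0 cpa_addN.

Lemma coef0 p : (0 : cpa) p = 0. Proof. by []. Qed.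
Lemma coefD (x y : cpa) p : (x + y) p = x p + y p. Proof. by []. Qed.
Lemma coefN (x : cpa) p : (- x) p = - x p. Proof. by []. Qed.
Lemma coefB (x y : cpa) p : (x - y) p = x p - y p. Proof. by []. Qed.
Lemma coef_sum (I : Type) (r : seq I) (P : pred I) (F : I -> cpa) p :
  (\sum_(i <- r | P i) F i) p = \sum_(i <- r | P i) F i p.
Proof. by elim/big_rec2: _ => // i y x _ <-. Qed.

Definition cpa1 : cpa := Cpa (fun p => (plen p == 0%N)%:R).
Definition cpa_mul (x y : cpa) : cpa :=
  Cpa (fun p => \sum_(k < (plen p).+1) x (ptake k p) * y (pdrop k p)).

Fact cpa_mulA : associative cpa_mul.
Proof.
move=> x y z; apply: cpaP => p /=; apply: esym.
transitivity (\sum_(k < (plen p).+1) \sum_(l < (plen p).+1 | (l <= k)%N)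
   x (ptake l p) * (y (ptake (k - l) (pdrop l p)) * z (pdrop k p))).
  apply: eq_bigr => k _; rewrite plen_ptake; last by rewrite -ltnS.
  rewrite mulr_suml.
  rewrite (big_ord_widen (plen p).+1
    (fun l => x (ptake l (ptake k p)) * y (pdrop l (ptake k p)) * z (pdrop k p))) //.
  by apply: eq_big => [l|l]; rewrite ltnS // => lk; rewrite ptake_ptake // pdrop_ptake // mulrA.
rewrite (exchange_big_dep predT) //=; apply: eq_bigr => l _.
rewrite -mulr_sumr; congr (_ * _).
rewrite -(big_mkord (fun k => (l <= k)%N)
   (fun k => y (ptake (k - l) (pdrop l p)) * z (pdrop k p))).
rewrite -(big_mkord predT
   (fun k => y (ptake k (pdrop l p)) * z (pdrop k (pdrop l p)))).
have lp : (l <= plen p)%N by rewrite -ltnS.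
rewrite (big_cat_nat (leq0n l) (leqW lp)) //= [X in X + _]big_nat_cond big1 ?add0r; last first.
  by move=> k /andP[/andP[_ kl] lk]; move: (leq_ltn_trans lk kl); rewrite ltnn.
rewrite -[X in \sum_(X <= _ < _ | _) _]add0n big_addn subSn // plen_pdrop.
apply: eq_big => [k|k _]; first by rewrite leq_addl.
by rewrite addnK pdrop_pdrop addnC.
Qed.

Fact cpa_mul1 : left_id cpa1 cpa_mul.
Proof.
move=> x; apply: cpaP => p /=; rewrite big_ord_recl /= big1 ?addr0 => [|k _].
  by rewrite plen_ptake // eqxx mul1r pdrop0.
by rewrite plen_ptake ?ltn_ord // mul0r.
Qed.

Fact cpa_mulr1 : right_id cpa1 cpa_mul.
Proof.
move=> x; apply: cpaP => p /=; rewrite big_ord_recr /= big1 ?add0r => [|k _].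
  by rewrite plen_pdrop subnn eqxx mulr1 ptake_oversize.
by rewrite plen_pdrop subn_eq0 leqNgt ltn_ord mulr0.
Qed.

Fact cpa_mulDl : left_distributive cpa_mul +%R.
Proof.
by move=> x y z; apply: cpaP => p /=; rewrite -big_split; apply: eq_bigr => k _; rewrite mulrDl.
Qed.

Fact cpa_mulDr : right_distributive cpa_mul +%R.
Proof.
by move=> x y z; apply: cpaP => p /=; rewrite -big_split; apply: eq_bigr => k _; rewrite mulrDr.
Qed.

HB.instance Definition _ := GRing.Zmodule_isPzRing.Build cpa
  cpa_mulA cpa_mul1 cpa_mulr1 cpa_mulDl cpa_mulDr.

Lemma coefM (x y : cpa) p :
  (x * y) p = \sum_(k < (plen p).+1) x (ptake k p) * y (pdrop k p).
Proof. by []. Qed.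

Definition cpa_scale (c : K) (x : cpa) : cpa := Cpa (fun p => c * x p).

Fact cpa_scaleA c d x : cpa_scale c (cpa_scale d x) = cpa_scale (c * d) x.
Proof. by apply: cpaP => p /=; rewrite mulrA. Qed.
Fact cpa_scale1 : left_id 1 cpa_scale.
Proof. by move=> x; apply: cpaP => p /=; rewrite mul1r. Qed.
Fact cpa_scaleDr : right_distributive cpa_scale +%R.
Proof. by move=> c x y; apply: cpaP => p /=; rewrite mulrDr. Qed.
Fact cpa_scaleDl x : {morph cpa_scale^~ x : c d / c + d}.
Proof. by move=> c d; apply: cpaP => p /=; rewrite mulrDl. Qed.

HB.instance Definition _ := GRing.Zmodule_isLmodule.Build K cpa
  cpa_scaleA cpa_scale1 cpa_scaleDr cpa_scaleDl.

Lemma coefZ c (x : cpa) p : (c *: x) p = c * x p. Proof. by []. Qed.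

Lemma cpa_scalerAl c (x y : cpa) : c *: (x * y) = (c *: x) * y.
Proof.
by apply: cpaP => p; rewrite coefZ !coefM mulr_sumr; apply: eq_bigr => k _; rewrite mulrA.
Qed.

Lemma cpa_scalerAr c (x y : cpa) : c *: (x * y) = x * (c *: y).
Proof.
by apply: cpaP => p; rewrite coefZ !coefM mulr_sumr; apply: eq_bigr => k _; rewrite mulrCA.
Qed.

Definition cpa_path (p : qpath Q) : cpa := Cpa (fun q => (q == p)%:R).
Definition idem (i : V) : cpa := cpa_path (ptriv i).
Definition cpa_arrow (a : arrow Q) : cpa := cpa_path (parrow a).

Lemma idem_sum : \sum_i idem i = 1.
Proof.
apply: cpaP => p; rewrite coef_sum /=; have [p0|pn0] := eqVneq.
  rewrite (bigD1 (source p)) //= qpath_eqE eqxx /= -size_eq0 -/(plen p) p0 big1 ?addr0 //.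
  by move=> i ip; rewrite qpath_eqE [_ == source _]eq_sym (negPf ip).
rewrite big1 // => i _; rewrite qpath_eqE -[arrows (ptriv i)]/[::] -size_eq0.
by rewrite (negPf pn0) andbF.
Qed.

Lemma coef_pathM (p q r : qpath Q) :
  (cpa_path p * cpa_path q) r
  = [&& source r == source p, target p == source q &
        arrows r == arrows p ++ arrows q]%:R.
Proof.
rewrite coefM; have [sr|sr] := boolP [&& _, _ & _].
  case/and3P: sr => /eqP sr /eqP tp /eqP ar.
  have lp : (plen p < (plen r).+1)%N by rewrite /plen ar size_cat ltnS leq_addr.
  have tr : take (plen p) (arrows r) = arrows p by rewrite ar take_size_cat.
  rewrite (bigD1 (Ordinal lp)) //= !qpath_eqE /source /arrows /= -/(source r) -/(arrows r).
  rewrite tr sr -/(source p) -/(arrows p) -/(source q) -/(arrows q) -/(target p) tp ar.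
  rewrite drop_size_cat // !eqxx mulr1 big1 ?addr0 // => k kp.
  case: eqP => [|_]; last by rewrite mul0r.
  move=> /(congr1 (@plen _ _)); rewrite plen_ptake; [move=> ek|by rewrite -ltnS].
  by rewrite -val_eqE /= ek eqxx in kp.
rewrite big1 // => k _; rewrite -natrM mulnb.
case: andP => // -[/eqP e1 /eqP e2]; case/negP: sr; rewrite -e1 -e2.
by rewrite /target /source /arrows /= !eqxx cat_take_drop eqxx.
Qed.

(* The topology is the adic one: neighbourhoods of 0 are the closed ideals of
   series supported on paths of length at least n. *)
Definition in_filtration (n : nat) (x : cpa) : Prop :=
  forall p, (plen p < n)%N -> x p = 0.

Definition in_aug (x : cpa) : Prop := in_filtration 1 x.

Definition in_corner (i j : V) (x : cpa) : Prop :=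
  exists y : cpa, x = idem i * y * idem j.

Lemma coef_idemM i (x : cpa) p : (idem i * x) p = x p *+ (source p == i).
Proof.
rewrite coefM big_ord_recl big1 ?addr0 => [|k _].
  by rewrite pdrop0 /= qpath_eqE /arrows /= take0 andbT mulr_natl.
by rewrite /= qpath_eqE -[arrows (ptriv _)]/[::] -size_eq0
  -/(plen _) plen_ptake ?ltn_ord // andbF mul0r.
Qed.

Lemma coef_Midem i (x : cpa) p : (x * idem i) p = x p *+ (target p == i).
Proof.
rewrite coefM big_ord_recr big1 ?add0r => [|k _].
  rewrite ptake_oversize // [ord_max : nat]/= mulr_natr qpath_eqE /source /arrows /=.
  by rewrite add0r take_size drop_size andbT.
by rewrite /= qpath_eqE -[arrows (ptriv _)]/[::] -size_eq0
  -/(plen _) plen_pdrop subn_eq0 leqNgt ltn_ord andbF mulr0.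
Qed.

Lemma coef_corner i j (x : cpa) p :
  (idem i * x * idem j) p = x p *+ ((source p == i) && (target p == j)).
Proof. by rewrite coef_Midem coef_idemM -mulrnA mulnb. Qed.

Lemma in_cornerP i j (x : cpa) :
  (forall p, ~~ ((source p == i) && (target p == j)) -> x p = 0) -> in_corner i j x.
Proof.
move=> x0; exists x; apply: cpaP => p; rewrite coef_corner.
by case: (boolP (_ && _)) => [|/x0].
Qed.

(* The continuous linear maps sigma, cderiv and Delta below are given by the
   coefficients of their values; sigma_path, cderiv_path and Delta_path compute
   them on paths. coef_seq x s is 0 when s is not a nontrivial path. *)
Definition coef_seq (x : cpa) (s : seq (arrow Q)) : K :=
  if s is a :: _ then if insub (src a, s) is Some p then x p else 0 else 0.

Definition sigma (x : cpa) : cpa :=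
  Cpa (fun q => if plen q == 0%N then x q
                else if is_cycle q then coef_seq x (rot 1 (arrows q)) else 0).

(* The coefficient of q in the derivative of a cycle p is the number of k such
   that p, rotated to start at its k-th arrow, is a followed by q. *)
Definition cderiv (a : arrow Q) (x : cpa) : cpa :=
  Cpa (fun q => if (source q == tgt a) && (target q == src a)
                then \sum_(k < (plen q).+1) coef_seq x (rotr k (a :: arrows q))
                else 0).

(* The completed tensor square: t stands for the formal sum of the
   (t p q) (p (x) q), and bimod_act t x for t acting on x by (p (x) q) . x = q x p,
   whose coefficient at r sums over the factorizations of r in three paths. *)
Definition ctens := qpath Q -> qpath Q -> K.

Definition tens (x y : cpa) : ctens := fun p q => x p * y q.

Definition Delta (b : arrow Q) (x : cpa) : ctens :=
  fun p q => if (target p == src b) && (source q == tgt b)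
             then coef_seq x (arrows p ++ b :: arrows q) else 0.

Definition bimod_act (t : ctens) (x : cpa) : cpa :=
  Cpa (fun r => \sum_(k < (plen r).+1) \sum_(l < (plen (pdrop k r)).+1)
         t (pdrop l (pdrop k r)) (ptake k r) * x (ptake l (pdrop k r))).

Lemma bimod_act_tens x y z : bimod_act (tens x y) z = y * z * x.
Proof.
apply: cpaP => r; rewrite -mulrA coefM; apply: eq_bigr => k _.
rewrite coefM mulr_sumr; apply: eq_bigr => l _.
by rewrite /tens [x _ * _]mulrC -mulrA [x _ * _]mulrC.
Qed.

Lemma coef_seq0 s : coef_seq 0 s = 0.
Proof. by case: s => //= a s; case: insub. Qed.

Lemma coef_seqD x y s : coef_seq (x + y) s = coef_seq x s + coef_seq y s.
Proof. by case: s => [|a s] /=; [rewrite addr0 | case: insub => //=; rewrite addr0]. Qed.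

Lemma coef_seqN x s : coef_seq (- x) s = - coef_seq x s.
Proof. by case: s => [|a s] /=; [rewrite oppr0 | case: insub => //=; rewrite oppr0]. Qed.

Lemma coef_seqB x y s : coef_seq (x - y) s = coef_seq x s - coef_seq y s.
Proof. by rewrite coef_seqD coef_seqN. Qed.

Lemma coef_seqZ c x s : coef_seq (c *: x) s = c * coef_seq x s.
Proof. by case: s => [|a s] /=; [rewrite mulr0 | case: insub => //=; rewrite mulr0]. Qed.

Lemma coef_seqE x p : (0 < plen p)%N -> coef_seq x (arrows p) = x p.
Proof.
case: p => [[i [|a s]]] // cp _; rewrite /coef_seq /arrows /=.
have ia : src a = i by move: (cp) => /= /andP[/eqP].
case: insubP => [q _ qE|]; last by rewrite ia => /negP[].
by congr (x _); apply: val_inj; rewrite qE /= ia.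
Qed.

Lemma coef_seq_path p s :
  coef_seq (cpa_path p) s = ((0 < plen p)%N && (arrows p == s))%:R.
Proof.
have [p0|p0] := boolP (0 < plen p)%N; last first.
  case: s => //= a s; case: insubP => //= q _ qE.
  by case: eqP => // qp; move: p0; rewrite -qp /plen /arrows qE.
case: eqP => [<-|np]; first by rewrite coef_seqE //= eqxx.
case: s np => //= a s np; case: insubP => //= q _ qE.
by case: eqP => // qp; case: np; rewrite -qp /arrows qE.
Qed.

Lemma Delta_path b p q r : Delta b (cpa_path p) q r =
  \sum_(j < plen p | nth b (arrows p) j == b)
     tens (cpa_path (ptake j p)) (cpa_path (pdrop j.+1 p)) q r.
Proof.
rewrite /Delta /tens /= coef_seq_path.
case: (boolP [&& target q == src b, source r == tgt b &
               arrows p == arrows q ++ b :: arrows r]) => [/and3P[qb rb /eqP pqr]|nqr].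
  have qp : (plen q < plen p)%N.
    by rewrite [plen p]/plen pqr size_cat /= addnS ltnS leq_addr.
  rewrite qb rb (leq_ltn_trans _ qp) //= pqr eqxx.
  rewrite (bigD1 (Ordinal qp)) /=; last first.
    by rewrite nth_cat ltnn subnn.
  rewrite big1 ?addr0 => [|j /andP[_ jq]].
    have tq : ptake (plen q) p = q.
      apply: qpath_eq; first exact: source_cat pqr (eqP qb).
      by rewrite [LHS]/arrows /= -/(arrows p) pqr take_size_cat.
    have dr : pdrop (plen q).+1 p = r.
      apply: qpath_eq; first by rewrite (source_pdrop b) // pqr nth_cat ltnn subnn /= (eqP rb).
      by rewrite [LHS]/arrows /= -/(arrows p) pqr -cat_rcons drop_size_cat // size_rcons.
    by rewrite tq dr !eqxx mulr1.
  case: eqP => [qj|]; last by rewrite mul0r.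
  by case/eqP: jq; apply: val_inj; rewrite /= qj plen_ptake // ltnW.
transitivity (0 : K).
  by case: ifP nqr => // /andP[-> ->] /= /negPf ->; rewrite andbF.
rewrite big1 // => j /eqP jb; case: eqP => [qj|]; last by rewrite mul0r.
case: eqP => [rj|]; last by rewrite mulr0.
case/negP: nqr; rewrite qj rj (target_ptake b) // (source_pdrop b) // jb !eqxx /=.
have -> : arrows (ptake j p) ++ b :: arrows (pdrop j.+1 p) = arrows p; last exact: eqxx.
by rewrite -[RHS](cat_take_drop j) (drop_nth b) // jb.
Qed.

Lemma cderiv_path a p : cderiv a (cpa_path p) =
  if is_cycle p then
    \sum_(j < plen p | nth a (arrows p) j == a)
       cpa_path (pdrop j.+1 p) * cpa_path (ptake j p)
  else 0.
Proof.
apply: cpaP => q; rewrite [LHS]/=.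
have E k : (k < plen p)%N -> plen p = (plen q).+1 ->
    (arrows p == rotr k (a :: arrows q))
    = (nth a (arrows p) k == a) && (arrows q == drop k.+1 (arrows p) ++ take k (arrows p)).
  move=> kp pq; rewrite -(inj_eq (@rot_inj k _)) rotrK /rot (@drop_nth _ a k) //=.
  by rewrite eqseq_cons [_ == arrows q]eq_sym.
have T k : (k < plen p)%N -> endpoint (source (pdrop k.+1 p)) (drop k.+1 (arrows p)) = target p.
  by move=> kp; rewrite /source /= -endpoint_cat cat_take_drop.
have [pq|pq] := eqVneq (plen p) (plen q).+1; last first.
  rewrite [X in if _ then X else _]big1 ?if_same => [|k _]; last first.
    rewrite coef_seq_path; case: (boolP (arrows p == _)) => [/eqP|]; last by rewrite andbF.
    by move/(congr1 size); rewrite size_rotr => /eqP; rewrite -/(plen p) /= -/(plen q) (negPf pq).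
  case: ifP => // _; rewrite coef_sum big1 // => j _; rewrite coef_pathM.
  case: and3P => // -[_ _ /eqP] /(congr1 size) /eqP.
  rewrite -/(plen q) size_cat -!/(plen _) plen_pdrop plen_ptake ?[(j <= _)%N]ltnW //.
  by rewrite -eqSS -addnS subnK // eq_sym (negPf pq).
transitivity (\sum_(k < plen p) (is_cycle p && (nth a (arrows p) k == a) &&
    ((source q == source (pdrop k.+1 p)) &&
     (arrows q == drop k.+1 (arrows p) ++ take k (arrows p))))%:R : K); last first.
  case: ifP => cp; last by rewrite big1.
  rewrite coef_sum [RHS]big_mkcond; apply: eq_bigr => k _.
  rewrite andTb; case: ifP => // ka; rewrite coef_pathM.
  by rewrite [target _]T // (eqP cp) eqxx.
rewrite -pq; transitivity (\sum_(k < plen p)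
    ((source q == tgt a) && (target q == src a) && (arrows p == rotr k (a :: arrows q)))%:R : K).
  case: ifP => _; last by rewrite big1.
  by apply: eq_bigr => k _; rewrite coef_seq_path (leq_ltn_trans _ (ltn_ord k)).
apply: eq_bigr => k _; rewrite E //; congr (_%:R); congr nat_of_bool.
case: (eqVneq (nth a (arrows p) k) a) => [ka|]; last by rewrite !andbF.
case: (eqVneq (arrows q) (drop k.+1 (arrows p) ++ _)) => [qE|]; last by rewrite !andbF.
rewrite (source_pdrop a) // ka !andbT.
case: (eqVneq (source q) (tgt a)) => [sq|]; last by rewrite andbF.
have tk : target (ptake k p) = src a by rewrite (target_ptake a) // ka.
have tq : target q = endpoint (target p) (take k (arrows p)).
  by rewrite /target qE endpoint_cat sq -{1}ka -source_pdrop // T.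
rewrite andbT; apply/eqP/eqP => [qa|cp]; last by rewrite tq cp -tk.
apply: (@composable_inj _ _ _ _ (take k (arrows p))); last by rewrite -tq qa -tk.
  have := qpathP q; rewrite -/(source q) -/(arrows q) qE composable_cat => /andP[_].
  by rewrite sq -{1}ka -source_pdrop // T.
exact: ptakeP.
Qed.

Lemma sigma_path p : sigma (cpa_path p) =
  if plen p == 0%N then cpa_path p
  else if is_cycle p then
    cpa_path (pdrop (plen p).-1 p) * cpa_path (ptake (plen p).-1 p)
  else 0.
Proof.
apply: cpaP => q; rewrite [LHS]/= coef_seq_path.
have [q0|q0] := eqVneq (plen q) 0%N.
  have [p0|p0] := eqVneq (plen p) 0%N; first by [].
  rewrite [LHS]/=; case: (eqVneq q p) => [qp|qp]; first by rewrite -qp q0 in p0.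
  case: ifP => // _; rewrite coef_pathM; case: and3P => // -[_ _ /eqP] /(congr1 size).
  rewrite -/(plen q) q0 size_cat -!/(plen _) plen_pdrop plen_ptake ?leq_pred //.
  by rewrite subnK ?leq_pred // => /esym/eqP; rewrite (negPf p0).
have [p0|p0] := eqVneq (plen p) 0%N.
  by rewrite p0 if_same /=; case: eqP => // qp; rewrite qp p0 in q0.
rewrite lt0n p0 andTb; have n1 : (plen p).-1.+1 = plen p by rewrite prednK // lt0n.
have rE : rotr 1 (arrows p) = drop (plen p).-1 (arrows p) ++ take (plen p).-1 (arrows p).
  by rewrite /rotr subn1.
have -> : (arrows p == rot 1 (arrows q)) = (arrows q == rotr 1 (arrows p)).
  by rewrite -(inj_eq (@rotr_inj 1 _)) rotK eq_sym.
have T : endpoint (source (pdrop (plen p).-1 p)) (drop (plen p).-1 (arrows p)) = target p.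
  by rewrite /source /= -endpoint_cat cat_take_drop.
have [qE|qE] := eqVneq (arrows q) (rotr 1 (arrows p)); last first.
  rewrite if_same; case: ifP => // _; rewrite coef_pathM -rE; case: and3P => // -[_ _ /eqP qE'].
  by rewrite qE' eqxx in qE.
transitivity ((is_cycle p && (source q == source (pdrop (plen p).-1 p)))%:R : K); last first.
  case: ifP => // cp; rewrite coef_pathM -rE qE eqxx andbT [target _]T (eqP cp).
  by rewrite eqxx andbT.
have sq : source q = source (pdrop (plen p).-1 p).
  have b : arrow Q by move: p0; rewrite /plen; case: (arrows p).
  have := qpathP q; have := qpathP (pdrop (plen p).-1 p).
  rewrite -!/(source _) -!/(arrows _) qE rE /=.
  rewrite -[arrows (pdrop _ _)]/(drop _ (arrows p)) (drop_nth b) -/(plen p) ?n1 //=.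
  by case/andP => /eqP <- _ /andP[/eqP <-].
have tq : target q = endpoint (target p) (take (plen p).-1 (arrows p)).
  by rewrite /target qE rE endpoint_cat sq T.
rewrite sq eqxx andbT; have -> : is_cycle q = is_cycle p; last by case: ifP.
rewrite /is_cycle tq sq; apply/eqP/eqP => [|->]; last by [].
apply: composable_inj; last exact: ptakeP.
by have := qpathP q; rewrite -/(source q) -/(arrows q) qE rE composable_cat sq T => /andP[].
Qed.

Fact sigma_is_linear : linear sigma.
Proof.
move=> c x y; apply: cpaP => q; rewrite coefD coefZ /=; case: ifP => // _.
by case: ifP => _; rewrite ?mulr0 ?addr0 // coef_seqD coef_seqZ.
Qed.

HB.instance Definition _ := GRing.isLinear.Build K cpa cpa *:%R sigma sigma_is_linear.

Fact cderiv_is_linear a : linear (cderiv a).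
Proof.
move=> c x y; apply: cpaP => q; rewrite coefD coefZ /=.
case: ifP => _; last by rewrite mulr0 addr0.
rewrite mulr_sumr -big_split; apply: eq_bigr => k _.
by rewrite coef_seqD coef_seqZ.
Qed.

HB.instance Definition _ a :=
  GRing.isLinear.Build K cpa cpa *:%R (cderiv a) (cderiv_is_linear a).

Definition closed_seq (s : seq (arrow Q)) : bool :=
  if s is a :: _ then composable (src a) s && (endpoint (src a) s == src a) else false.

Lemma closed_rot1 s : closed_seq s -> closed_seq (rot 1 s).
Proof.
case: s => // a [|b s] /=; rewrite /rot /= ?cats0 //= cats1 => /andP[].
rewrite !eqxx /= => /andP[/eqP bta sc] /eqP e; rewrite -cats1 composable_cat sc endpoint_cat /=.
by rewrite e bta !eqxx.
Qed.

Lemma closed_rot k s : closed_seq s -> closed_seq (rot k s).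
Proof.
move=> cs; elim: k => [|k IHk]; first by rewrite rot0.
have [ks|ks] := ltnP k (size s); first by rewrite rotS // closed_rot1.
by rewrite rot_oversize // leqW.
Qed.

Lemma coef_seq_sigma x s : closed_seq s -> coef_seq (sigma x) s = coef_seq x (rot 1 s).
Proof.
case: s => // a s /andP[cs es].
have sE : a :: s = arrows (@QPath _ _ (src a, a :: s) cs) by [].
by rewrite sE coef_seqE //= /is_cycle /target es.
Qed.

Lemma sum_rotr (F : seq (arrow Q) -> K) s :
  \sum_(k < size s) F (rotr k (rot 1 s)) = \sum_(k < size s) F (rotr k s).
Proof.
have rotrS k t : (k < size t)%N -> rotr k.+1 t = rotr k (rotr 1 t) :> seq (arrow Q).
  move=> kt; apply: (@rot_inj k); rewrite rotrK; apply: (@rot_inj 1).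
  by rewrite -rotS ?size_rotr // !rotrK.
case E : (size s) => [|n]; first by rewrite !big_ord0.
rewrite big_ord_recl [RHS]big_ord_recr addrC; congr (_ + _); last first.
  congr (F _); rewrite [nat_of_ord ord0]/= [nat_of_ord ord_max]/=.
  by rewrite [LHS]/rotr subn0 rot_size /rotr E subSnn.
by apply: eq_bigr => k _; rewrite rotrS ?size_rot ?E ?rotK // ltnW // ltnS.
Qed.

Lemma cderiv_sigma a x : cderiv a (sigma x) = cderiv a x.
Proof.
apply: cpaP => q /=; case: ifP => // /andP[/eqP sq /eqP tq].
have cq : closed_seq (a :: arrows q).
  rewrite /= eqxx -sq; have := qpathP q; rewrite -/(source q) -/(arrows q) => -> /=.
  by rewrite -/(target q) tq eqxx.
rewrite -[RHS](sum_rotr (coef_seq x) (a :: arrows q)); apply: eq_bigr => k _.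
by rewrite coef_seq_sigma ?closed_rot // -rot_rotr.
Qed.

Lemma cderiv_in_corner a x : in_corner (tgt a) (src a) (cderiv a x).
Proof. by apply: in_cornerP => q /negPf /= ->. Qed.

Lemma sum_arrowM (F : arrow Q -> cpa) p :
  (\sum_a cpa_arrow a * F a) p =
  if arrows p is a :: _ then F a (pdrop 1 p) else 0.
Proof.
rewrite coef_sum; case E : (arrows p) => [|a s].
  rewrite big1 // => a _; rewrite coefM big1 // => k _.
  by rewrite /= qpath_eqE [arrows (ptake _ _)]/arrows /= -/(arrows p) E andbF mul0r.
have p0 : (1 < (plen p).+1)%N by rewrite /plen E.
have sa : source p = src a.
  by have := qpathP p; rewrite -/(source p) -/(arrows p) E /= => /andP[/eqP].
have T c (k : nat) : (k < (plen p).+1)%N ->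
    (ptake k p == parrow c) = (k == 1%N) && (c == a).
  rewrite ltnS => kp; rewrite qpath_eqE; have [->|k1] := eqVneq k 1%N; last first.
    rewrite [X in _ && X](_ : _ = false) ?andbF //; apply/eqP => /(congr1 size) /eqP.
    by rewrite -/(plen _) plen_ptake // (negPf k1).
  rewrite [arrows (ptake _ _)]/arrows /= -/(arrows p) E /= take0 eqseq_cons andbT.
  by rewrite [a == c]eq_sym andbC; case: eqP => // ->; rewrite [source _]sa eqxx.
rewrite (bigD1 a) // big1 ?Monoid.mulm1 => [|b ba]; last first.
  by rewrite coefM big1 // => k _; rewrite /= T // (negPf ba) andbF mul0r.
rewrite coefM (bigD1 (Ordinal p0)) //= T // !eqxx mul1r big1 ?Monoid.mulm1 // => k ks.
by rewrite /= T // -[_ == 1%N]/(k == Ordinal p0) (negPf ks) mul0r.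
Qed.

Lemma sum_Marrow (F : arrow Q -> cpa) p b s : arrows p = rcons s b ->
  (\sum_a F a * cpa_arrow a) p = F b (ptake (size s) p).
Proof.
move=> E; rewrite coef_sum.
have np : plen p = (size s).+1 by rewrite /plen E size_rcons.
have drE k : (k <= size s)%N -> arrows (pdrop k p) = rcons (drop k s) b.
  by move=> ks; rewrite /arrows /= -/(arrows p) E drop_rcons.
have T (a : arrow Q) (k : nat) : (k < (plen p).+1)%N ->
    (pdrop k p == parrow a) = (k == size s) && (a == b).
  rewrite ltnS np => kp; rewrite qpath_eqE.
  have [->|ks] := eqVneq k (size s); last first.
    rewrite [X in _ && X](_ : _ = false) ?andbF //; apply/eqP => /(congr1 size).
    rewrite -/(plen _) plen_pdrop np /= => e.
    by move: (subnKC kp); rewrite e addn1 => -[] /eqP; rewrite (negPf ks).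
  rewrite drE // drop_size /= eqseq_cons andbT [b == a]eq_sym andbC.
  case: eqP => // ->; rewrite (@source_cat _ _ (pdrop (size s) p) (ptriv (src b)) b [::]) //.
    exact: eqxx.
  by rewrite drE // drop_size.
have sp : (size s < (plen p).+1)%N by rewrite np leqW.
rewrite (bigD1 b) // big1 ?Monoid.mulm1 => [|a ab]; last first.
  by rewrite coefM big1 // => k _; rewrite /= T // (negPf ab) andbF mulr0.
rewrite coefM (bigD1 (Ordinal sp)) //= T // !eqxx mulr1 big1 ?Monoid.mulm1 // => k ks.
by rewrite /= T // -[_ == size s]/(k == Ordinal sp) (negPf ks) mulr0.
Qed.

Lemma sum_commutator_cderiv x :
  \sum_a (cpa_arrow a * cderiv a x - cderiv a x * cpa_arrow a) = 0.
Proof.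
apply: cpaP => p; rewrite sumrB coefB sum_arrowM coef0.
case/lastP E : (arrows p) => [|s b].
  rewrite sub0r coef_sum big1 ?oppr0 // => a _; rewrite coefM big1 // => k _.
  by rewrite /= (qpath_eqE (pdrop _ _)) [arrows (pdrop _ _)]/arrows /= -/(arrows p) E andbF mulr0.
have np : plen p = (size s).+1 by rewrite /plen E size_rcons.
rewrite (sum_Marrow _ E) -E; apply/eqP; rewrite subr_eq0; apply/eqP.
transitivity (if is_cycle p
              then \sum_(k < (size s).+1) coef_seq x (rotr k (arrows p)) else 0).
  case F : (arrows p) => [|a t]; first by move: np; rewrite /plen F.
  have st : size t = size s by move: np; rewrite /plen F => -[].
  have tE : arrows (pdrop 1 p) = t by rewrite /arrows /= -/(arrows p) F /= drop0.
  have tp : target (pdrop 1 p) = target p.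
    by rewrite /target /source /= -endpoint_cat cat_take_drop.
  have sp : source p = src a.
    by have := qpathP p; rewrite -/(source p) -/(arrows p) F /= => /andP[/eqP].
  rewrite /= (source_pdrop a) ?np // F eqxx tp /is_cycle sp tE.
  by have -> : plen (pdrop 1 p) = size s by rewrite /plen tE.
have sE : arrows (ptake (size s) p) = s.
  by rewrite /arrows /= -/(arrows p) E -cats1 take_size_cat.
have tp : target p = tgt b by rewrite /target E -cats1 endpoint_cat.
rewrite /= (target_ptake b) ?np // E nth_rcons ltnn eqxx eqxx andbT /is_cycle tp sE.
rewrite [source (ptake _ _)]/(source p) eq_sym; case: ifP => // _.
have -> : plen (ptake (size s) p) = size s by rewrite /plen sE.
rewrite -[RHS](sum_rotr (coef_seq x) (b :: s)).
by apply: eq_bigr => k _; rewrite rot1_cons.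
Qed.

(* HH_0 is the cokernel of id - sigma. *)
Definition im_id_sub_sigma : {pred cpa} :=
  fun x => `[< exists y, x = y - sigma y >].

Lemma im_id_sub_sigmaP x :
  reflect (exists y, x = y - sigma y) (x \in im_id_sub_sigma).
Proof. exact: asboolP. Qed.

Fact im_id_sub_sigma_zmod_closed : zmod_closed im_id_sub_sigma.
Proof.
split=> [|x y /im_id_sub_sigmaP[x' ->] /im_id_sub_sigmaP[y' ->]].
  by apply/im_id_sub_sigmaP; exists 0; rewrite linear0 subr0.
apply/im_id_sub_sigmaP; exists (x' - y').
by rewrite [sigma (_ - _)]linearB !opprD !opprK addrACA.
Qed.

HB.instance Definition _ :=
  GRing.isZmodClosed.Build cpa im_id_sub_sigma im_id_sub_sigma_zmod_closed.

Definition HH0 : Type := Quotient.quot im_id_sub_sigma.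
HB.instance Definition _ := GRing.Zmodule.on HH0.

Definition HH0_class (x : cpa) : HH0 := \pi_HH0 x.

Lemma HH0_classP x y :
  HH0_class x = HH0_class y <-> exists z, x - y = z - sigma z.
Proof.
split=> [/eqP|xy]; last first.
  by apply/eqP; rewrite -[_ == _]Quotient.idealrBE; apply/im_id_sub_sigmaP.
by rewrite -[_ == _]Quotient.idealrBE => /im_id_sub_sigmaP.
Qed.

Lemma HH0_class_repr (W : HH0) : HH0_class (repr W) = W.
Proof. exact: reprK. Qed.

Lemma HH0_classD x y : HH0_class (x + y) = HH0_class x + HH0_class y.
Proof. exact: (raddfD (\pi_(Quotient.quot im_id_sub_sigma))). Qed.

Definition HH0_scale (c : K) (W : HH0) : HH0 := HH0_class (c *: repr W).

Lemma HH0_scaleE c x : HH0_scale c (HH0_class x) = HH0_class (c *: x).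
Proof.
have /HH0_classP[z zE] := HH0_class_repr (HH0_class x).
by apply/HH0_classP; exists (c *: z); rewrite -scalerBr zE scalerBr [sigma (_ *: _)]linearZ.
Qed.

Fact HH0_scaleA c d W : HH0_scale c (HH0_scale d W) = HH0_scale (c * d) W.
Proof. by rewrite [HH0_scale d W]/HH0_scale HH0_scaleE scalerA. Qed.
Fact HH0_scale1 : left_id 1 HH0_scale.
Proof. by move=> W; rewrite /HH0_scale scale1r HH0_class_repr. Qed.
Fact HH0_scaleDr : right_distributive HH0_scale +%R.
Proof.
move=> c W W'; rewrite -[in LHS](HH0_class_repr W) -[in LHS](HH0_class_repr W').
by rewrite -HH0_classD HH0_scaleE scalerDr HH0_classD.
Qed.
Fact HH0_scaleDl W : {morph HH0_scale^~ W : c d / c + d}.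
Proof. by move=> c d; rewrite /HH0_scale scalerDl HH0_classD. Qed.

HB.instance Definition _ := GRing.Zmodule_isLmodule.Build K HH0
  HH0_scaleA HH0_scale1 HH0_scaleDr HH0_scaleDl.

Lemma HH0_classZ c x : HH0_class (c *: x) = c *: HH0_class x.
Proof. by rewrite -HH0_scaleE. Qed.

(* (A_+)_sigma, seen inside HH_0(A) = A_sigma: A is the direct sum of A_+ and of
   the span of the trivial paths, and sigma preserves both. *)
Definition is_potential (W : HH0) : Prop := exists2 x, in_aug x & W = HH0_class x.

Definition pot_deriv (a : arrow Q) (W : HH0) : cpa := cderiv a (repr W).

Lemma pot_deriv_class a x : pot_deriv a (HH0_class x) = cderiv a x.
Proof.
have /HH0_classP[z zE] := HH0_class_repr (HH0_class x).
by apply/eqP; rewrite -subr_eq0 -linearB zE linearB /= cderiv_sigma subrr.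
Qed.

Lemma pot_derivZ a c W : pot_deriv a (c *: W) = c *: pot_deriv a W.
Proof. by rewrite -{1}(HH0_class_repr W) -HH0_classZ pot_deriv_class linearZ. Qed.

Record hyperpotential := Hyperpotential {
  hyper_val :> arrow Q -> cpa;
  hyper_corner : forall a, in_corner (tgt a) (src a) (hyper_val a);
  hyper_commutator :
    \sum_a (cpa_arrow a * hyper_val a - hyper_val a * cpa_arrow a) = 0
}.

Definition pot_hyper (W : HH0) : hyperpotential :=
  @Hyperpotential (fun a => pot_deriv a W)
    (fun a => cderiv_in_corner a (repr W)) (sum_commutator_cderiv (repr W)).

Fact hyper_scale_corner c (r : hyperpotential) a :
  in_corner (tgt a) (src a) (c *: r a).
Proof.
by have [y ->] := hyper_corner r a; exists (c *: y); rewrite -cpa_scalerAr cpa_scalerAl.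
Qed.

Fact hyper_scale_commutator c (r : hyperpotential) :
  \sum_a (cpa_arrow a * (c *: r a) - (c *: r a) * cpa_arrow a) = 0.
Proof.
rewrite -[RHS](scaler0 _ c) -[in RHS](hyper_commutator r) scaler_sumr.
apply: eq_bigr => a _.
by rewrite -cpa_scalerAr -cpa_scalerAl scalerBr.
Qed.

Definition hyper_scale (c : K) (r : hyperpotential) : hyperpotential :=
  @Hyperpotential (fun a => c *: r a) (hyper_scale_corner c r) (hyper_scale_commutator c r).

End CompletedPathAlgebra.

Section Equivalences.
Variables (K : comPzRingType) (V : finType) (Q Q' : quiver V).
Local Notation A := (cpa K Q).
Local Notation A' := (cpa K Q').

Definition adic_continuous (f : A -> A') : Prop :=
  forall x n, exists m, forall y,
    in_filtration m (y - x) -> in_filtration n (f y - f x).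

(* With aug = false, f ranges over all continuous algebra isomorphisms fixing the
   trivial paths; with aug = true, over those that also map A_+ into A'_+. The
   extra condition is automatic when K is reduced. Otherwise a continuous
   isomorphism may add nilpotent constants to loops, such as x |-> x + c on
   K[[x]]; the image of a potential in HH_0 may then have constant terms, which
   cyclic derivatives do not see. *)
Record is_equivalence (aug : bool) (f : A -> A') : Prop := IsEquivalence {
  equivalence_linear : linear f;
  equivalence_monoid : monoid_morphism f;
  equivalence_continuous : adic_continuous f;
  equivalence_bijective : bijective f;
  equivalence_idem : forall i, f (idem K Q i) = idem K Q' i;
  equivalence_aug : aug -> forall x, in_aug x -> in_aug (f x)
}.

(* This does not depend on the representative when f is an algebra morphism: the
   elements y - sigma y are the finite sums of commutators. *)
Definition HH0_map (f : A -> A') (W : HH0 K Q) : HH0 K Q' := HH0_class (f (repr W)).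

Definition right_equivalent (aug : bool) (W : HH0 K Q) (W' : HH0 K Q') : Prop :=
  exists2 f, is_equivalence aug f & HH0_map f W = W'.

Definition invertible (c : K) : Prop := exists d, c * d = 1.

Definition weakly_right_equivalent (aug : bool) (W : HH0 K Q) (W' : HH0 K Q') : Prop :=
  exists f c, [/\ is_equivalence aug f, invertible c & HH0_map f (c *: W) = W'].

Definition hyper_push (f : A -> A') (r : arrow Q -> A) (b : arrow Q') : A' :=
  \sum_a bimod_act (Delta b (f (cpa_arrow K a))) (f (r a)).

Definition hyper_right_equivalent (aug : bool)
    (r : hyperpotential K Q) (r' : hyperpotential K Q') : Prop :=
  exists2 f, is_equivalence aug f & forall b, hyper_push f r b = r' b.

Definition hyper_weakly_right_equivalent (aug : bool)
    (r : hyperpotential K Q) (r' : hyperpotential K Q') : Prop :=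
  exists2 c, invertible c & hyper_right_equivalent aug (hyper_scale c r) r'.

End Equivalences.

Definition contains_rat (K : comPzRingType) : Prop :=
  exists f : {rmorphism rat -> K}, injective f.

Definition reduced_ring (K : comPzRingType) : Prop :=
  forall (x : K) n, x ^+ n = 0 -> x = 0.

(* Main.v *)
From HB Require Import structures.
From mathcomp Require Import all_boot all_order all_algebra.
From mathcomp Require Import boolp.
Require Import Defs.

(** Write D_b(x, z) for the action of Delta_b(x) on z; informally D_b(x, z)
    removes one occurrence of b from x and reads what remains cyclically, with
    z inserted between the end and the beginning of x.  Two facts make D_b
    useful.  The cyclic derivative is D_b(x, 1) (cderivE), and since Delta_b is
    a double derivation, D_b obeys the cyclic Leibniz rule
      D_b(xy, z) = D_b(x, yz) + D_b(y, zx)     (Delta_act_mul).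

    The heart of the proof is the chain rule: for a continuous algebra morphism
    f fixing the trivial paths,
      D_b(f(x), f(z)) = sum over a of D_b(f(a), f(D_a(x, z)))
    (Delta_act_chain).  Both sides are linear in x, continuous in z and obey the
    cyclic Leibniz rule, and they agree when x is a trivial path or an arrow.
    By cyclic_derivation_eq0 this forces them to be equal: writing x as a
    combination of trivial paths plus a sum of terms a x_a, the rule replaces
    (x, z) by the pairs (x_a, z a), so that after many steps z lies deep in the
    filtration.  At z = 1 the chain rule says that pushing forward the
    derivatives of W along f yields the derivatives of f(W), which settles the
    direct implication, with the same f and the same scalar.

    For the converse, the chain rule turns an equivalence of hyperpotentials
    into the equality of all cyclic derivatives of f(W) and W', and it remains
    to see that cyclic derivatives separate potentials when K contains Q
    (pot_deriv_inj).  If all of them vanish on u, then for every cycle the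
    coefficients of u on its n rotations add up to 0, and dividing by n
    exhibits u as z - sigma(z), provided that u has no constant terms
    (cderiv_eq0).  For u = f(W) - W' this proviso asks f to preserve the
    augmentation ideal.  When this is not assumed, K is reduced, and then it is
    automatic: the powers of an arrow tend to 0, hence so do those of its image
    under f, whose constant coefficients are therefore nilpotent
    (equivalence_in_aug). *)

Set Implicit Arguments.
Unset Strict Implicit.
Unset Printing Implicit Defensive.

Import GRing.Theory.

Local Open Scope ring_scope.

(** * The double derivation and its action *)

Section Derivations.
Variables (K : comPzRingType) (V : finType) (Q : quiver V).
Local Notation A := (cpa K Q).
Implicit Types (x y z : A) (p q r : qpath Q) (a b : arrow Q).

Lemma target_pdrop k p : target (pdrop k p) = target p.
Proof. by rewrite /target /source /arrows /= -endpoint_cat cat_take_drop. Qed.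

(** Coassociativity of deconcatenation: cutting a path in three pieces may begin
    with either cut.  Arbitrary T are needed because the tensors acted upon
    below are infinite sums of pure tensors. *)
Lemma sum_three_factors (T : qpath Q -> qpath Q -> qpath Q -> K) r :
  \sum_(k < (plen r).+1) \sum_(l < (plen (pdrop k r)).+1)
     T (ptake k r) (ptake l (pdrop k r)) (pdrop l (pdrop k r))
  = \sum_(m < (plen r).+1) \sum_(k < (plen (ptake m r)).+1)
     T (ptake k (ptake m r)) (pdrop k (ptake m r)) (pdrop m r).
Proof.
apply: esym.
transitivity (\sum_(m < (plen r).+1) \sum_(k < (plen r).+1 | (k <= m)%N)
   T (ptake k r) (ptake (m - k) (pdrop k r)) (pdrop m r)).
  apply: eq_bigr => m _; rewrite plen_ptake; last by rewrite -ltnS.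
  rewrite (big_ord_widen (plen r).+1 (fun k =>
    T (ptake k (ptake m r)) (pdrop k (ptake m r)) (pdrop m r))) //.
  by apply: eq_big => [k|k]; rewrite ltnS // => km; rewrite ptake_ptake // pdrop_ptake.
rewrite (exchange_big_dep predT) //=; apply: eq_bigr => k _.
rewrite -(big_mkord (fun m => (k <= m)%N)
   (fun m => T (ptake k r) (ptake (m - k) (pdrop k r)) (pdrop m r))).
rewrite -(big_mkord predT
   (fun l => T (ptake k r) (ptake l (pdrop k r)) (pdrop l (pdrop k r)))).
have kr : (k <= plen r)%N by rewrite -ltnS.
rewrite (big_cat_nat (leq0n k) (leqW kr)) /= [X in X + _]big_nat_cond.
rewrite [X in X + _]big1 ?add0r; last first.
  by move=> m /andP[/andP[_ mk] km]; move: (leq_ltn_trans km mk); rewrite ltnn.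
rewrite -[X in \sum_(X <= _ < _ | _) _]add0n big_addn subSn // plen_pdrop.
apply: eq_big => [l|l _]; first by rewrite leq_addl.
by rewrite addnK pdrop_pdrop addnC.
Qed.

(** Fixing one of the two variables of a tensor turns its action into ordinary
    products, so that the action of a product can be computed with the
    associativity of the algebra.  With the second variable fixed, factors can
    be moved across the right side of z; with the first one fixed, as in the
    next lemma, across its left side. *)
Lemma bimod_act_slicel (t : ctens K Q) z r :
  bimod_act t z r
  = \sum_(k < (plen r).+1) (z * Cpa (fun p => t p (ptake k r))) (pdrop k r).
Proof.
by apply: eq_bigr => k _; rewrite coefM; apply: eq_bigr => l _; rewrite mulrC.
Qed.

Lemma bimod_act_slicer (t : ctens K Q) z r :
  bimod_act t z r
  = \sum_(k < (plen r).+1) (Cpa (t (pdrop k r)) * z) (ptake k r).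
Proof. exact: (sum_three_factors (fun p1 p2 p3 => t p3 p1 * z p2)). Qed.

Lemma bimod_actD (t u : ctens K Q) z :
  bimod_act (fun p q => t p q + u p q) z = bimod_act t z + bimod_act u z.
Proof.
apply: cpaP => r; rewrite coefD /= -big_split; apply: eq_bigr => k _.
by rewrite -big_split; apply: eq_bigr => l _; rewrite mulrDl.
Qed.

Lemma bimod_actZ c (t : ctens K Q) z :
  bimod_act (fun p q => c * t p q) z = c *: bimod_act t z.
Proof.
apply: cpaP => r; rewrite coefZ /= mulr_sumr; apply: eq_bigr => k _.
by rewrite mulr_sumr; apply: eq_bigr => l _; rewrite mulrA.
Qed.

Fact bimod_act_is_linear (t : ctens K Q) : linear (bimod_act t).
Proof.
move=> c x y; apply: cpaP => r; rewrite coefD coefZ !bimod_act_slicel.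
rewrite mulr_sumr -big_split; apply: eq_bigr => k _.
by rewrite mulrDl -cpa_scalerAl coefD coefZ.
Qed.
HB.instance Definition _ t :=
  GRing.isLinear.Build K A A *:%R (bimod_act t) (bimod_act_is_linear t).

Lemma bimod_act_filtration n (t : ctens K Q) z :
  in_filtration n z -> in_filtration n (bimod_act t z).
Proof.
move=> zn r rn /=; rewrite big1 // => k _; rewrite big1 // => l _.
rewrite zn ?mulr0 // plen_ptake; last by rewrite -ltnS.
apply: leq_ltn_trans rn; apply: leq_trans (leq_subr k _).
by rewrite -plen_pdrop -ltnS.
Qed.

(** Delta_b(xy) = x Delta_b(y) + Delta_b(x) y: a cut of the path p b q falls
    either inside p or inside q. *)
Lemma DeltaM b x y p q :
  Delta b (x * y) p q
  = \sum_(k < (plen p).+1) x (ptake k p) * Delta b y (pdrop k p) q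
  + \sum_(k < (plen q).+1) Delta b x p (ptake k q) * y (pdrop k q).
Proof.
rewrite /Delta; under eq_bigr do rewrite target_pdrop.
rewrite -/(source q); case: ifP => [/andP[/eqP pb /eqP qb]|_]; last first.
  by rewrite !big1 ?addr0 // => k _; rewrite ?mul0r ?mulr0.
have cr : composable (source p) (arrows p ++ b :: arrows q).
  by rewrite composable_cat [composable _ (arrows p)]qpathP /= -pb eqxx /= -qb; exact: qpathP.
(* r is the path p b q; its cuts are those of p followed by those of q. *)
pose r := @QPath _ _ (source p, arrows p ++ b :: arrows q) cr.
have coef_join (u : A) (s : qpath Q) : (0 < plen s)%N -> forall t, t = arrows s -> coef_seq u t = u s.
  by move=> ? t ->; exact: coef_seqE.
have nr : plen r = (plen p + (plen q).+1)%N by rewrite /plen /= size_cat.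
rewrite (coef_join (x * y) r) ?nr ?addnS // coefM nr addnS -addnS -addSn.
rewrite big_split_ord /=; congr (_ + _); apply: eq_bigr => k _.
  have kp : (k <= plen p)%N by rewrite -ltnS.
  have tk : take k (arrows r) = take k (arrows p) by rewrite takel_cat.
  have drop_p : arrows (pdrop k r) = arrows (pdrop k p) ++ b :: arrows q.
    transitivity (drop k (arrows p ++ b :: arrows q)); first by [].
    rewrite drop_cat -/(plen p); case: ltngtP kp => // ek _.
    by rewrite [arrows (pdrop k p)]drop_oversize -/(plen p) ek ?subnn ?drop0.
  congr (_ * _); first by congr (x _); apply: qpath_eq.
  rewrite (coef_join y (pdrop k r)) ?plen_pdrop ?nr.
  - by [].
  - by rewrite subn_gt0 addnS ltnS (leq_trans kp) ?leq_addr.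
  - by rewrite drop_p.
have tk : take ((plen p).+1 + k) (arrows r) = arrows p ++ b :: take k (arrows q).
  by rewrite [arrows r]/(_ ++ _) take_cat -/(plen p) ltnNge addSnnS leq_addr addKn.
congr (_ * _).
  rewrite (coef_join x (ptake ((plen p).+1 + k) r)) // plen_ptake // nr addSnnS.
  by rewrite leq_add2l.
congr (y _); apply: qpath_eq.
  transitivity (endpoint (source p) (take ((plen p).+1 + k) (arrows r))); first by [].
  by rewrite tk endpoint_cat /= -qb.
transitivity (drop ((plen p).+1 + k) (arrows p ++ b :: arrows q)); first by [].
by rewrite drop_cat -/(plen p) ltnNge addSnnS leq_addr addKn.
Qed.

Fact Delta_act_is_linear b z : linear (fun x => bimod_act (Delta b x) z).
Proof.
move=> c x y; rewrite -bimod_actZ -bimod_actD; congr bimod_act.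
apply/funext => p; apply/funext => q; rewrite /Delta; case: ifP => _.
  by rewrite coef_seqD coef_seqZ.
by rewrite mulr0 addr0.
Qed.

(** Since a tensor u (x) v sends z to v z u, letting x Delta_b(y) act on z amounts to
    letting Delta_b(y) act on z x, and likewise for Delta_b(x) y and y z. *)
Lemma Delta_act_mul b x y z :
  bimod_act (Delta b (x * y)) z
  = bimod_act (Delta b x) (y * z) + bimod_act (Delta b y) (z * x).
Proof.
rewrite (_ : Delta b (x * y) = fun p q =>
   \sum_(k < (plen q).+1) Delta b x p (ptake k q) * y (pdrop k q)
   + \sum_(k < (plen p).+1) x (ptake k p) * Delta b y (pdrop k p) q); last first.
  by apply/funext => p; apply/funext => q; rewrite DeltaM addrC.
rewrite bimod_actD; congr (_ + _); apply: cpaP => r.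
  by rewrite !bimod_act_slicer; apply: eq_bigr => k _; rewrite mulrA.
by rewrite !bimod_act_slicel; apply: eq_bigr => k _; rewrite -mulrA.
Qed.

Lemma Delta_act_idem b i z : bimod_act (Delta b (idem K Q i)) z = 0.
Proof.
apply: cpaP => r; rewrite /= big1 // => k _; rewrite big1 // => l _.
by rewrite /Delta coef_seq_path if_same mul0r.
Qed.

Lemma Delta_act_arrow b a z :
  bimod_act (Delta b (cpa_arrow K a)) z
  = if a == b then idem K Q (tgt b) * z * idem K Q (src b) else 0.
Proof.
have -> : Delta b (cpa_arrow K a) = fun p q =>
    (if a == b then tens (idem K Q (src b)) (idem K Q (tgt b)) p q else 0).
  apply/funext => p; apply/funext => q.
  rewrite Delta_path big_mkcond big_ord_recl big_ord0 Monoid.mulm1 /=.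
  case: eqP => // <-.
  have -> : ptake 0 (parrow a) = ptriv (src a) by exact: qpath_eq.
  by have -> : pdrop 1 (parrow a) = ptriv (tgt a) by exact: qpath_eq.
case: eqP => _; first by rewrite bimod_act_tens.
by apply: cpaP => r; rewrite /= big1 // => k _; rewrite big1 // => l _; rewrite mul0r.
Qed.

(** Both sides sum the coefficients of x on the rotations of b q; one index counts
    rotations from the left and the other from the right. *)
Lemma cderivE b x : cderiv b x = bimod_act (Delta b x) 1.
Proof.
apply: cpaP => r; rewrite bimod_act_slicel [LHS]/=.
under [RHS]eq_bigr => k _ do rewrite mul1r [Cpa _ _]/= /Delta target_pdrop.
rewrite -/(source r) andbC; case: ifP => _; last by rewrite big1.
rewrite (reindex_inj rev_ord_inj); apply: eq_bigr => k _; congr coef_seq.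
have kr : (k <= plen r)%N by rewrite -ltnS.
by rewrite /rotr /= -/(plen r) subSS subSn ?leq_subr // subKn.
Qed.

End Derivations.

(** * Decomposition along the first arrow *)

Section Decomposition.
Variables (K : comPzRingType) (V : finType) (Q : quiver V).
Local Notation A := (cpa K Q).
Implicit Types (x y z : A) (p q r : qpath Q) (a b : arrow Q).

Definition left_quotient a x : A :=
  Cpa (fun q => if source q == tgt a then coef_seq x (a :: arrows q) else 0).

Lemma left_decomposition x :
  x = \sum_i x (ptriv i) *: idem K Q i
      + \sum_a cpa_arrow K a * left_quotient a x.
Proof.
apply: cpaP => p; rewrite coefD sum_arrowM coef_sum.
case E : (arrows p) => [|a s].
  have pE : p = ptriv (source p) by exact: qpath_eq.
  rewrite addr0 (bigD1 (source p)) // coefZ /= -pE eqxx mulr1 big1 ?Monoid.mulm1 // => i ip.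
  by have /negPf-> : p != ptriv i; [apply: contraNneq ip => -> | rewrite mulr0].
rewrite big1 ?Monoid.mul1m => [|i _]; last first.
  by rewrite coefZ /= qpath_eqE E andbF mulr0.
have p1 : (0 < plen p)%N by rewrite /plen E.
have sE : arrows (pdrop 1 p) = s.
  by transitivity (drop 1 (arrows p)); rewrite // E /= drop0.
by rewrite [RHS]/= (source_pdrop a) // E eqxx sE -(coef_seqE x p1) E.
Qed.

Lemma in_filtrationM m n x y :
  in_filtration m x -> in_filtration n y -> in_filtration (m + n) (x * y).
Proof.
move=> xm yn p pmn; rewrite coefM big1 // => k _.
have kp : (k <= plen p)%N by rewrite -ltnS.
have [km|mk] := ltnP k m; first by rewrite xm ?mul0r // plen_ptake.
by rewrite yn ?mulr0 // plen_pdrop ltn_subLR // (leq_trans pmn) // leq_add2r.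
Qed.

Lemma in_filtration_arrow a : in_filtration 1 (cpa_arrow K a).
Proof. by move=> p p0 /=; case: eqP p0 => // ->. Qed.

Lemma coef_trivM x y i : (x * y) (ptriv i) = x (ptriv i) * y (ptriv i).
Proof.
rewrite coefM big_ord_recl big_ord0 Monoid.mulm1 /=.
have -> : ptake 0 (ptriv i : qpath Q) = ptriv i by exact: qpath_eq.
by rewrite pdrop0.
Qed.

End Decomposition.

(** * Uniqueness of cyclic derivations *)

Section Uniqueness.
Variables (K : comPzRingType) (V : finType) (Q Q' : quiver V).
Local Notation A := (cpa K Q).
Local Notation A' := (cpa K Q').

(** The Leibniz rule and the decomposition of x along its first arrow give
    E(x, z) = sum over a of E(x_a, z a), where the second argument has gained one
    arrow; continuity in z alone, uniformly in x, then pushes E(x, z) into every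
    step of the filtration. *)
Lemma cyclic_derivation_eq0 (E : A -> A -> A') :
  (forall z, linear (fun x => E x z)) ->
  (forall x y z, E (x * y) z = E x (y * z) + E y (z * x)) ->
  (forall i z, E (idem K Q i) z = 0) ->
  (forall a z, E (cpa_arrow K a) z = 0) ->
  (forall n, exists m, forall x z, in_filtration m z -> in_filtration n (E x z)) ->
  forall x z, E x z = 0.
Proof.
move=> Elin EM Eidem Earrow Econt.
have rotate x z : E x z = \sum_a E (left_quotient a x) (z * cpa_arrow K a).
  pose Ez : {linear A -> A'} := HB.pack (fun x => E x z)
    (GRing.isLinear.Build _ _ _ _ (fun x => E x z) (Elin z)).
  rewrite -[LHS]/(Ez x) {1}(left_decomposition x) linearD !linear_sum.
  rewrite big1 ?add0r => [|i _]; last by rewrite linearZ /= Eidem scaler0.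
  by apply: eq_bigr => a _; rewrite /= EM Earrow add0r.
have small n m x z : in_filtration m z -> in_filtration n (E x z).
  have [N EN] := Econt n; have [k Nk] := ubnP (N - m).
  (* Induction on the number N - m of arrows that z still lacks. *)
  elim: k => // k IHk in m x z Nk *; move=> zm p pn.
  have [Nm|mN] := leqP N m; first by apply: (EN x z) => // q /leq_trans-/(_ _ Nm)/zm.
  rewrite rotate coef_sum big1 // => a _; apply: (IHk m.+1) pn.
    by rewrite subnS prednK ?subn_gt0.
  by rewrite -addn1; apply: in_filtrationM => //; exact: in_filtration_arrow.
by move=> x z; apply: cpaP => p; apply: (small (plen p).+1 0%N).
Qed.

End Uniqueness.

(** * The chain rule *)

Section ChainRule.
Variables (K : comPzRingType) (V : finType) (Q Q' : quiver V).
Local Notation A := (cpa K Q).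
Local Notation A' := (cpa K Q').
Variables (aug : bool) (f : A -> A').
Hypothesis f_eqv : is_equivalence aug f.

Let f_linear := equivalence_linear f_eqv.
#[local] HB.instance Definition _ := GRing.isLinear.Build K A A' *:%R f f_linear.

Let f1 : f 1 = 1. Proof. exact: (equivalence_monoid f_eqv).1. Qed.
Let fM x y : f (x * y) = f x * f y. Proof. exact: (equivalence_monoid f_eqv).2. Qed.
Let f_idem := equivalence_idem f_eqv.

Let f_continuous0 n : exists m, forall x, in_filtration m x -> in_filtration n (f x).
Proof.
have [m fm] := equivalence_continuous f_eqv 0 n; exists m => x xm p pn.
by rewrite -(subr0 (f x)) -(linear0 f); apply: fm pn => q qm; rewrite subr0 xm.
Qed.

(** The difference of the two sides is a cyclic derivation, so only trivial paths
    and arrows need checking. *)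
Lemma Delta_act_chain b x z :
  bimod_act (Delta b (f x)) (f z)
  = \sum_a bimod_act (Delta b (f (cpa_arrow K a)))
             (f (bimod_act (Delta a x) z)).
Proof.
apply/eqP; rewrite -subr_eq0; apply/eqP; move: x z.
apply: cyclic_derivation_eq0 => [z c x y|x y z|i z|c z|n].
- rewrite linearP (Delta_act_is_linear b (f z)) scalerBr scaler_sumr.
  rewrite -addrA -addrA; congr (_ + _).
  rewrite addrCA -opprD; congr (_ - _); rewrite -big_split; apply: eq_bigr => a _.
  by rewrite (Delta_act_is_linear a z) linearP linearP.
- rewrite fM Delta_act_mul !fM addrACA -opprD -big_split; congr (_ - _).
  by apply: eq_bigr => a _; rewrite Delta_act_mul !linearD.
- rewrite f_idem Delta_act_idem big1 ?subr0 // => a _.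
  by rewrite Delta_act_idem !linear0.
- rewrite (bigD1 c) // big1 ?Monoid.mulm1 => [|a ac]; last first.
    by rewrite Delta_act_arrow eq_sym (negPf ac) !linear0.
  rewrite Delta_act_arrow eqxx !fM !f_idem.
  (* The idempotents at the ends of c can be moved onto z by the Leibniz rule. *)
  have {1}-> : cpa_arrow K c = idem K Q (src c) * cpa_arrow K c * idem K Q (tgt c).
    apply: cpaP => p; rewrite coef_corner /=; case: eqP => [->|]; last by rewrite mul0rn.
    by rewrite !eqxx.
  by rewrite !fM !f_idem !Delta_act_mul !Delta_act_idem addr0 add0r subrr.
have [m fm] := f_continuous0 n; exists m => x z zm p pn.
rewrite coefB (bimod_act_filtration _ (fm _ zm)) // sub0r coef_sum big1 ?oppr0 // => a _.
by apply: bimod_act_filtration pn; apply: fm; exact: bimod_act_filtration.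
Qed.

Theorem cderiv_chain b x : cderiv b (f x) = hyper_push f (fun a => cderiv a x) b.
Proof.
by rewrite cderivE -f1 Delta_act_chain; apply: eq_bigr => a _; rewrite cderivE.
Qed.

(** Over a reduced ring, continuity forces f to preserve the augmentation ideal: for
    m large, the constant coefficient of f(a ^ m), which is the m-th power of that
    of f(a), vanishes. *)
Lemma equivalence_in_aug : aug \/ reduced_ring K -> forall x, in_aug x -> in_aug (f x).
Proof.
case=> [|K_red]; first exact: equivalence_aug f_eqv.
have triv_arrow a i : f (cpa_arrow K a) (ptriv i) = 0.
  have [m fm] := f_continuous0 1; apply: (K_red _ m).
  have -> : f (cpa_arrow K a) (ptriv i) ^+ m = f (cpa_arrow K a ^+ m) (ptriv i).
    elim: m {fm} => [|m IHm]; first by rewrite !expr0 f1.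
    by rewrite !exprS IHm fM coef_trivM.
  apply: fm => //; rewrite -[m in in_filtration m]mul1n.
  elim: m => [|m IHm]; first by [].
  by rewrite exprS mulnS; apply: in_filtrationM => //; exact: in_filtration_arrow.
move=> x x0 p; rewrite ltnS leqn0 => /nilP p0.
have -> : p = ptriv (source p) by exact: qpath_eq.
rewrite (left_decomposition x) linearD !linear_sum big1 ?add0r => [|i _]; last first.
  by rewrite x0 // scale0r linear0.
by rewrite coef_sum big1 // => a _; rewrite /= fM coef_trivM triv_arrow mul0r.
Qed.

End ChainRule.

(** * Potentials with vanishing cyclic derivatives *)

Section Kernel.
Variables (K : comPzRingType) (V : finType) (Q : quiver V).
Local Notation A := (cpa K Q).

Lemma HH0_classK x : exists z : A, repr (HH0_class x) = x + (z - sigma z).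
Proof.
by have /HH0_classP[z zE] := HH0_class_repr (HH0_class x); exists z; rewrite -zE addrC subrK.
Qed.

(** sigma fixes constant terms, so all representatives of a class share them. *)
Lemma repr_potential (W : HH0 K Q) : is_potential W -> in_aug (repr W).
Proof.
case=> x x0 ->; have [z ->] := HH0_classK x; move=> p p0.
move: (p0); rewrite ltnS leqn0 => /eqP p0'.
by rewrite coefD coefB x0 // add0r /= p0' eqxx subrr.
Qed.

(** The sum over the rotations of a cycle a q is the coefficient of q in the
    derivative with respect to a. *)
Lemma cderiv_eq0_sum_rot (x : A) s : closed_seq s -> (forall a, cderiv a x = 0) ->
  \sum_(k < size s) coef_seq x (rot k s) = 0.
Proof.
case: s => // a s /andP[/= /andP[_ cs] /eqP es] x0.
pose q := @QPath _ _ (tgt a, s) cs.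
have sq : source q = tgt a by [].
have tq : target q = src a by exact: es.
transitivity (cderiv a x q); last by rewrite x0.
rewrite [RHS]/= sq tq !eqxx.
transitivity (\sum_(k < (size s).+1) coef_seq x (rotr k (a :: s))); last by [].
have := sum_rotr (coef_seq x) (rotr 1 (a :: s)); rewrite rotrK size_rotr [size (_ :: _)]/= => ->.
rewrite [RHS](reindex_inj rev_ord_inj); apply: eq_bigr => k _; congr coef_seq.
have ks : (k <= size s)%N by rewrite -ltnS.
rewrite -[in LHS](rotrK 1 (a :: s)) rot_rot -rotS ?size_rotr //.
by rewrite [RHS]/rotr size_rotr /= subSS subSn ?leq_subr // subKn.
Qed.

(** On a nontrivial cycle s of length n, take z(s) = - (1/n) sum_k k x(rot k s).  Then
    z(s) - z(rot 1 s) telescopes, by summation by parts, to x(s) minus 1/n times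
    the sum of x over all rotations of s, which is 0.  Off the cycles sigma
    vanishes, and z = x will do. *)
Lemma cderiv_eq0 (x : A) : contains_rat K -> in_aug x ->
  (forall a, cderiv a x = 0) -> exists z, x = z - sigma z.
Proof.
case=> f _ x0 dx.
pose w s : K := f (- (size s)%:R^-1) * \sum_(k < size s) k%:R * coef_seq x (rot k s).
pose z : A := Cpa (fun p => if is_cycle p then w (arrows p) else x p).
exists z; apply: cpaP => p; rewrite coefB /=.
have [p0|p0] := eqVneq (plen p) 0%N; first by rewrite subrr x0 // p0.
rewrite -lt0n in p0.
case: ifP => [cp|_]; last by rewrite subr0.
have cs : closed_seq (arrows p).
  move: p0 cp (qpathP p); rewrite /is_cycle /target /plen -/(source p) -/(arrows p).
  by case: (arrows p) => //= a s _ /eqP <- /andP[/eqP -> ->]; rewrite !eqxx.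
have cE : coef_seq z (rot 1 (arrows p)) = w (rot 1 (arrows p)).
  move: (closed_rot1 cs); case: (rot 1 _) => // a s /andP[c e].
  have -> : a :: s = arrows (@QPath _ _ (src a, a :: s) c) by [].
  by rewrite coef_seqE //= /is_cycle /target e.
rewrite cE /w size_rot -mulrBr; set s := arrows p in cs cE *; set n := size s.
have n0 : (0 < n)%N by [].
pose F k := coef_seq x (rot k s).
have F0 : \sum_(k < n) F k = 0 by exact: cderiv_eq0_sum_rot.
have FS : \sum_(k < n) F k.+1 = 0.
  have : \sum_(k < n.+1) F k = \sum_(k < n.+1) F k by [].
  rewrite {1}big_ord_recl big_ord_recr F0 /= {1}/F rot0 /F /n rot_size.
  by rewrite addrC => /addrI.
(* Summation by parts; the boundary term is n x(s), since rot n s = s. *)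
have rS (k : 'I_n) :
    k%:R * coef_seq x (rot k (rot 1 s)) = k.+1%:R * F k.+1 - F k.+1.
  by rewrite rot_rot -rotS // -natr1 mulrDl mul1r addrK.
under [X in _ - X]eq_bigr do rewrite rS.
rewrite sumrB FS subr0.
have -> : \sum_(k < n) k.+1%:R * F k.+1 = \sum_(k < n) k%:R * F k + n%:R * x p.
  have : \sum_(k < n.+1) k%:R * F k = \sum_(k < n.+1) k%:R * F k by [].
  by rewrite {1}big_ord_recl big_ord_recr mul0r add0r /F rot_size coef_seqE.
rewrite opprD addNKr mulrN -mulNr -rmorphN opprK mulrA -(rmorph_nat f) -rmorphM.
by rewrite mulVf ?rmorph1 ?mul1r // Num.Theory.pnatr_eq0 -lt0n.
Qed.

Lemma is_potentialZ c (W : HH0 K Q) : is_potential W -> is_potential (c *: W).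
Proof.
case=> x x0 ->; exists (c *: x); last by rewrite HH0_classZ.
by move=> p p0; rewrite coefZ x0 ?mulr0.
Qed.

Lemma pot_deriv_inj (W W' : HH0 K Q) :
  contains_rat K -> is_potential W -> is_potential W' ->
  (forall a, pot_deriv a W = pot_deriv a W') -> W = W'.
Proof.
move=> ratK potW potW' dWW'.
rewrite -(HH0_class_repr W) -(HH0_class_repr W'); apply/HH0_classP.
apply: cderiv_eq0 => // [p p0|a].
  by rewrite coefB !repr_potential // subrr.
by rewrite linearB [X in X - _]dWW' subrr.
Qed.

End Kernel.

(** * Equivalences acting on potentials *)

Section Potentials.
Variables (K : comPzRingType) (V : finType) (Q Q' : quiver V).
Variables (aug : bool) (f : cpa K Q -> cpa K Q').
Hypothesis f_eqv : is_equivalence aug f.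

Lemma pot_deriv_map (W : HH0 K Q) b :
  hyper_push f (fun a => pot_deriv a W) b = pot_deriv b (HH0_map f W).
Proof. by rewrite pot_deriv_class (cderiv_chain f_eqv). Qed.

Lemma is_potential_map (W : HH0 K Q) :
  aug \/ reduced_ring K -> is_potential W -> is_potential (HH0_map f W).
Proof.
move=> augK potW; exists (f (repr W)) => //.
exact: equivalence_in_aug f_eqv augK _ (repr_potential potW).
Qed.

Lemma hyper_push_scale (W : HH0 K Q) c b :
  hyper_push f (hyper_scale c (pot_hyper W)) b = pot_deriv b (HH0_map f (c *: W)).
Proof.
by rewrite -pot_deriv_map; apply: eq_bigr => a _; rewrite pot_derivZ.
Qed.

End Potentials.

Theorem lemma2p5 (K : comPzRingType) (V : finType) (Q Q' : quiver V)
    (W : HH0 K Q) (W' : HH0 K Q') (hW : is_potential W) (hW' : is_potential W')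
    (aug : bool) :
  ((right_equivalent aug W W' ->
    hyper_right_equivalent aug (pot_hyper W) (pot_hyper W')) /\
   (weakly_right_equivalent aug W W' ->
    hyper_weakly_right_equivalent aug (pot_hyper W) (pot_hyper W'))) /\
  (contains_rat K -> aug \/ reduced_ring K ->
   (hyper_right_equivalent aug (pot_hyper W) (pot_hyper W') ->
    right_equivalent aug W W') /\
   (hyper_weakly_right_equivalent aug (pot_hyper W) (pot_hyper W') ->
    weakly_right_equivalent aug W W')).
Proof.
split; split.
- by case=> f f_eqv fW; exists f => // b; rewrite (pot_deriv_map f_eqv) fW.
- case=> f [c [f_eqv c_inv fW]]; exists c => //; exists f => // b.
  by rewrite (hyper_push_scale f_eqv) fW.
- case=> f f_eqv dfW; exists f => //; apply: pot_deriv_inj => // [|b].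
    exact: is_potential_map f_eqv _ _ _.
  by rewrite -(pot_deriv_map f_eqv) dfW.
case=> c c_inv [f f_eqv dfW]; exists f, c; split=> //.
apply: pot_deriv_inj => // [|b].
  exact: is_potential_map f_eqv _ _ (is_potentialZ _ _).
by rewrite -(hyper_push_scale f_eqv) dfW.
Qed.
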